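(* For every fixed integer $\ell\ge2$ and $k$ sufficiently large, $$R_k(C_{2\ell+1})\le\frac{2\ell}{2\ell-1}(2\ell-1)^k(k!)^{1/\ell}\exp\!\left(k^{1-1/\ell}+O_\ell\!\left(k^{1-2/\ell}+\log k\right)\right)+1.$$
   Context: $C_m$ denotes the cycle on $m$ vertices. The $k$-color Ramsey number $R_k(H)$ of a graph $H$ is the smallest integer $n$ such that every edge-coloring of the complete graph $K_n$ with $k$ colors contains a monochromatic copy of $H$ (as a not necessarily induced subgraph). $\log$ is the natural logarithm. The $O_\ell$ notation means: for every integer $\ell\ge 2$ there exist constants $C$ and $k_0$ depending only on $\ell$ such that for every integer $k\ge k_0$ the inequality holds with the $O_\ell(\cdot)$ term replaced by some real number $E_k$ with $|E_k|\le C\,(k^{1-2/\ell}+\log k)$. *)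

(* Defs.v *)
From mathcomp Require Import all_boot.

Set Implicit Arguments.
Unset Strict Implicit.
Unset Printing Implicit Defensive.

Record sgraph := SGraph {
  vertex :> finType;
  adj : rel vertex;
  adj_sym : symmetric adj;
  adj_irrefl : irreflexive adj }.

(* ordS is the successor modulo m; the conjunct x != y only matters for m = 1,
   so this is the usual cycle for every m >= 3. *)
Definition cycle_adj (m : nat) : rel 'I_m :=
  fun x y => (x != y) && ((y == ordS x) || (x == ordS y)).

Lemma cycle_adj_sym m : symmetric (@cycle_adj m).
Proof. by move=> x y; rewrite /cycle_adj eq_sym orbC. Qed.

Lemma cycle_adj_irrefl m : irreflexive (@cycle_adj m).
Proof. by move=> x; rewrite /cycle_adj eqxx. Qed.

Definition cycle_graph (m : nat) : sgraph :=
  SGraph (@cycle_adj_sym m) (@cycle_adj_irrefl m).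

Definition Kedge (n : nat) : finType := {e : {set 'I_n} | #|e| == 2}.

Definition coloring (k n : nat) : finType := {ffun Kedge n -> 'I_k}.

Definition mono_copy (k n : nat) (H : sgraph) (chi : coloring k n) : bool :=
  [exists f : {ffun H -> 'I_n}, exists a : 'I_k,
    injectiveb f &&
    [forall x : H, forall y : H, adj x y ==>
      [forall e : Kedge n, (val e == [set f x; f y]) ==> (chi e == a)]]].

Definition ramsey_prop (k : nat) (H : sgraph) (n : nat) : bool :=
  [forall chi : coloring k n, mono_copy H chi].

Section RamseyExistence.

Fixpoint ramsey_size (k r : nat) : nat :=
  if r is r'.+1 then (k * ramsey_size k r').+1 else 0.

Lemma ramsey_seq (V : finType) k (col : V -> V -> 'I_k.+1) r (A : {set V}) :
  ramsey_size k.+1 r <= #|A| ->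
  exists s : seq (V * 'I_k.+1),
    [/\ size s = r, all (fun p => p.1 \in A) s &
        pairwise (fun p q => (p.1 != q.1) && (col p.1 q.1 == p.2)) s].
Proof.
elim: r A => [|r IHr] A /= leA; first by exists [::].
have /card_gt0P[x xA] : 0 < #|A| by apply: leq_trans leA.
pose B c := [set y in A :\ x | col x y == c].
have [c leB] : exists c, ramsey_size k.+1 r <= #|B c|.
  apply/existsP; apply: contraLR leA => /existsPn ltB; rewrite -ltnNge ltnS.
  rewrite (cardsD1 x) xA add1n.
  have -> : #|A :\ x| = \sum_c #|B c|.
    rewrite -sum1_card (partition_big (col x) predT) //=.
    apply: eq_bigr => c _; rewrite -sum1_card; apply: eq_bigl => y.
    by rewrite [RHS]inE.
  have {}ltB c : #|B c| < ramsey_size k.+1 r by rewrite ltnNge ltB.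
  have [n En] : exists n, ramsey_size k.+1 r = n.+1.
    by case: (ramsey_size k.+1 r) (ltB ord0) => [|n _] //; exists n.
  apply: (@leq_ltn_trans (\sum_(c < k.+1) n)).
    by apply: leq_sum => c _; rewrite -ltnS -En ltB.
  by rewrite sum_nat_const card_ord En ltn_pmul2l.
have [s [szs sB ps]] := IHr _ leB.
exists ((x, c) :: s); split=> /=; first by rewrite szs.
  rewrite xA; apply: sub_all sB => p; rewrite !inE => /andP[/andP[_ ->]] //.
rewrite ps andbT; apply: sub_all sB => p /=.
by rewrite !inE => /andP[/andP[px _] ->]; rewrite eq_sym px.
Qed.

Lemma ramsey_exists (k : nat) (H : sgraph) : exists n, ramsey_prop k H n.
Proof.
case: k => [|k].
  exists 2; apply/forallP => chi.
  have e2 : #|[set: 'I_2]| == 2 by rewrite cardsT card_ord.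
  by case: (chi (Sub [set: 'I_2] e2)).
exists (ramsey_size k.+1 (k.+1 * #|H|).+1); set n := ramsey_size _ _.
apply/forallP => chi.
pose col (x y : 'I_n) : 'I_k.+1 :=
  if (insub [set x; y] : option (Kedge n)) is Some e then chi e else ord0.
have [|s [szs _ ps]] := @ramsey_seq 'I_n k col (k.+1 * #|H|).+1 [set: 'I_n].
  by rewrite cardsT card_ord.
have [a lea] : exists a, #|H| <= size [seq p <- s | p.2 == a].
  apply/existsP; apply: contraT => /existsPn lts.
  have : size s <= k.+1 * #|H|.
    have -> : size s = \sum_a size [seq p <- s | p.2 == a].
      rewrite -sum1_size (partition_big snd predT) //=.
      by apply: eq_bigr => a _; rewrite -big_filter sum1_size.
    rewrite -[X in X * _]card_ord -sum_nat_const; apply: leq_sum => a _.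
    by apply: ltnW; rewrite ltnNge lts.
  by rewrite szs ltnn.
set t := [seq p <- s | p.2 == a] in lea.
have pt := pairwise_filter (fun p => p.2 == a) ps.
rewrite -/t in pt.
have [p0 _] : exists p0 : 'I_n * 'I_k.+1, True.
  by case: s szs {ps t lea pt} => // p; exists p.
have szt (x : H) : enum_rank x < size t by apply: leq_trans (ltn_ord _) lea.
have nt (x y : H) : enum_rank x < enum_rank y ->
    ((nth p0 t (enum_rank x)).1 != (nth p0 t (enum_rank y)).1) &&
    (col (nth p0 t (enum_rank x)).1 (nth p0 t (enum_rank y)).1 == a).
  move=> lxy; have := pairwiseP p0 pt (enum_rank x) (enum_rank y).
  rewrite !inE !szt => /(_ isT isT lxy) /andP[-> /eqP->].
  by have := mem_nth p0 (szt x); rewrite mem_filter => /andP[].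
have nn (x y : H) : x != y ->
    ((nth p0 t (enum_rank x)).1 != (nth p0 t (enum_rank y)).1) &&
    (col (nth p0 t (enum_rank x)).1 (nth p0 t (enum_rank y)).1 == a).
  move=> nxy; case: (ltngtP (enum_rank x) (enum_rank y)) => [||exy].
  - exact: nt.
  - by move/nt; rewrite eq_sym /col setUC.
  - by rewrite (enum_rank_inj (val_inj exy)) eqxx in nxy.
apply/existsP; exists [ffun x => (nth p0 t (enum_rank x)).1].
apply/existsP; exists a; apply/andP; split.
  apply/injectiveP => x y; rewrite !ffunE => exy; apply/eqP.
  by apply: contraT => /nn; rewrite exy eqxx.
apply/forallP => x; apply/forallP => y; apply/implyP => xy.
apply/forallP => e; apply/implyP; rewrite !ffunE => /eqP ve.
have /nn/andP[_] : x != y.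
  by apply: contraTneq xy => ->; rewrite adj_irrefl.
by rewrite /col -ve valK.
Qed.

End RamseyExistence.

Definition ramsey (k : nat) (H : sgraph) : nat := ex_minn (ramsey_exists k H).

(* Main.v *)
Require Import Defs.
From mathcomp Require Import all_boot all_order all_algebra.
From mathcomp Require Import reals sequences exp.
From mathcomp Require Import ring lra zify.
Import Order.TTheory GRing.Theory Num.Theory.
Local Open Scope ring_scope.

(** Fix a colouring of the edges of a complete graph with no monochromatic
cycle of length 2l+1.  Two facts drive the bound.

In one colour class, the vertices at distance j from a given vertex v, for
1 <= j <= l, split into 2l-1 independent sets ([layer_heavy_independent]).
Order the layer lexicographically by the tree path to v.  If the splitting
failed there would be an edge path along 2l vertices of the layer, monotone in
this order; a window of it of the right length closes up through the lowest
common ancestor of its ends into a cycle of length exactly 2l+1.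

The second fact is a weighted induction that replaces the usual recursion on
the number of colours, whose difficulty is that the colour degrees of different
vertices may be very unequal.  Every vertex x carries a list L x of the colours
that its edges may have, and a vertex with a colours in its list weighs 1 / g a,
where g a / g (a - 1) = (2l-1) X a.  The total weight never exceeds 1
([list_weight_sum]).  Otherwise let v be a vertex with the shortest list, of
length a, and i the colour that has the heaviest neighbourhood of v, so of
weight at least about 1/a.  Let y j be the weight of the j-th layer around v in
colour i.  Keep only a heavy independent set I of layer j, throw away the rest
of the layers j - 1, j, j + 1, and delete i from the lists on I: the lists
remain correct, the discarded weight is y (j-1) + y j + y (j+1), and the
relisted set weighs at least X a * y j.  If the latter is larger for some
1 <= j < l, the total weight grows while the configuration shrinks, so it was at
most 1 by induction.  If not, write X a = q + 1 + 1/q; the differences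
y j - y (j-1) / q grow by a factor q at each step, so y l is at least about
q ^ (l-1) / a, while y l <= 1 / X a by induction applied to the last layer.  The two
are incompatible as soon as X a * q ^ (l-1) slightly exceeds a.

Applied to n vertices with full lists this gives n <= g k.  The value
q = s - 1/l + 1/s with s = a ^ (1/l) suffices, because
(s + 1/s) ^ l >= a + l and (q + 1/l) ^ l <= q ^ l + q ^ (l-1) + q ^ (l-2).  Then
X a <= s * exp ((1 - 1/l) / s + 3 / s ^ 2), and the product over a <= k has
exponent k ^ (1 - 1/l) + O (k ^ (1 - 2/l) + log k). *)

Set Implicit Arguments.
Unset Strict Implicit.
Unset Printing Implicit Defensive.

(** * Distance layers of a graph without a cycle of length 2l+1 *)

Section Layers.
Local Open Scope nat_scope.
Variables (V : finType) (e : rel V) (v : V).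
Hypotheses (e_sym : symmetric e) (e_irr : irreflexive e).

Fixpoint ball (j : nat) : {set V} :=
  if j is j'.+1 then ball j' :|: [set y | [exists x in ball j', e x y]]
  else [set v].

Definition layer (j : nat) : {set V} :=
  if j is j'.+1 then ball j :\: ball j' else [set v].

Lemma ball_mono i j : i <= j -> ball i \subset ball j.
Proof.
move/subnK<-; elim: (j - i) => [|d IHd] //=.
exact: subset_trans IHd (subsetUl _ _).
Qed.

Lemma ball_step j x y : x \in ball j -> e x y -> y \in ball j.+1.
Proof.
by move=> xj exy; rewrite /= !inE; apply/orP; right; apply/exists_inP; exists x.
Qed.

Lemma layer_ball j : layer j \subset ball j.
Proof. by case: j => [|j] //; rewrite subsetDl. Qed.

Lemma layer_out i j x : i < j -> x \in layer j -> x \notin ball i.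
Proof.
case: j => [|j] //; rewrite ltnS inE => leij /andP[xj _].
by apply: contra xj; apply/subsetP/ball_mono.
Qed.

Lemma layer_neighbor j x y : x \in layer j.+1 -> e x y ->
  y \in layer j :|: layer j.+1 :|: layer j.+2.
Proof.
move=> xj exy; have xb : x \in ball j.+1 by apply: subsetP xj; apply: layer_ball.
have yb := ball_step xb exy; rewrite !in_setU.
have [yj1|yj1] := boolP (y \in ball j.+1); last by rewrite [y \in layer j.+2]inE yb yj1 orbT.
have [yj|yj] := boolP (y \in ball j); last by rewrite [y \in layer j.+1]inE yj1 yj orbT.
suff -> : y \in layer j by [].
case: j xj yj {xb yb yj1} => [|j] //= xj yj.
rewrite inE yj andbT; apply: contraL xj => yj'.
by rewrite inE (ball_step yj') // e_sym.
Qed.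

Lemma layer_pred j x : x \in layer j.+1 -> exists2 y, y \in layer j & e y x.
Proof.
move=> xj; have := xj; rewrite inE /= !inE => /andP[/negPf-> /=].
case/exists_inP => y yj eyx; exists y => //.
case: j xj yj => [|j] //= xj yj.
rewrite inE yj andbT; apply: contraL xj => yj'.
by rewrite inE (ball_step yj' eyx).
Qed.

Definition parent (j : nat) (x : V) : V :=
  odflt x [pick y in layer j | e y x].

Lemma parentP j x : x \in layer j.+1 ->
  (parent j x \in layer j) && e (parent j x) x.
Proof.
case/layer_pred=> y yj eyx; rewrite /parent; case: pickP => [z //|/(_ y)].
by rewrite yj eyx.
Qed.

(** The ranks of the vertices on the tree path from [v] to [x], read as the digits
of a number in base #|V|: comparing keys is the lexicographic order, and dividing
by #|V| ^ t climbs [t] generations ([key_div]). *)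
Fixpoint key (j : nat) (x : V) : nat :=
  if j is j'.+1 then key j' (parent j' x) * #|V| + enum_rank x
  else enum_rank x.

Lemma card_gt0V : 0 < #|V|.
Proof. by apply/card_gt0P; exists v. Qed.

Lemma key_div j x t : key j.+1 x %/ #|V| ^ t.+1 = key j (parent j x) %/ #|V| ^ t.
Proof.
rewrite expnS divnMA /= divnMDl ?card_gt0V //.
by rewrite (divn_small (ltn_ord (enum_rank x))) addn0.
Qed.

Lemma key_inj j : injective (key j).
Proof.
move=> x y kxy; apply/enum_rank_inj/val_inj.
case: j kxy => [|j] //= /(congr1 (modn^~ #|V|)).
by rewrite !modnMDl !modn_small.
Qed.

Lemma key_root j x : x \in layer j -> key j x %/ #|V| ^ j = enum_rank v.
Proof.
elim: j x => [|j IHj] x; first by rewrite inE => /eqP->; rewrite divn1.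
by case/parentP/andP=> xj _; rewrite key_div IHj.
Qed.

(** Two vertices whose ancestors first meet [t.+1] generations up are joined
through that common ancestor by a path below their own layer. *)
Lemma tree_path t j x y : t < j -> x \in layer j -> y \in layer j ->
    key j x %/ #|V| ^ t != key j y %/ #|V| ^ t ->
    key j x %/ #|V| ^ t.+1 = key j y %/ #|V| ^ t.+1 ->
  exists p, [/\ size p = t.*2.+1, uniq p, {subset p <= ball j.-1}
             & path e x (rcons p y)].
Proof.
elim: t j x y => [|t IHt] [|j] // x y; rewrite ltnS => lt_tj xj yj.
  rewrite !key_div !divn1 => _ /key_inj pxy.
  have /andP[pj ex] := parentP xj; have /andP[_ ey] := parentP yj.
  exists [:: parent j x]; split=> //=.
    by move=> z /[!inE]/eqP->; apply: subsetP pj; apply: layer_ball.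
  by rewrite e_sym ex pxy ey.
rewrite !key_div.
have /andP[pxj ex] := parentP xj; have /andP[pyj ey] := parentP yj.
move=> neq eq1; have [p [szp up sp pp]] := IHt _ _ _ lt_tj pxj pyj neq eq1.
have j0 : j.-1 < j by case: (j) lt_tj.
exists (parent j x :: rcons p (parent j y)); split.
- by rewrite /= size_rcons szp doubleS.
- rewrite /= mem_rcons rcons_uniq up inE !negb_or /= andbT.
  rewrite (contra (sp _) (layer_out j0 pxj)) (contra (sp _) (layer_out j0 pyj)).
  by rewrite !andbT; apply: contraNneq neq => ->.
- move=> z; rewrite inE mem_rcons inE => /or3P[/eqP->|/eqP->|/sp zj].
  + by apply: subsetP pxj; apply: layer_ball.
  + by apply: subsetP pyj; apply: layer_ball.
  + by apply: subsetP zj; apply: ball_mono; apply: leq_pred.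
- by rewrite /= e_sym ex /= rcons_path pp last_rcons ey.
Qed.

(** Let [t.+1] be the height of the meeting point of the two ends of the chain.
Keys being monotone, any window of the chain meets at that height or lower, and
exactly at that height once it contains an edge whose two ends differ [t]
generations up.  The window with 2l+1 - 2(t+1) edges fits in the chain, can be
placed around such an edge, and closes into a cycle of length 2l+1. *)
Lemma layer_chain_cycle l j (f : nat -> V) : 0 < j <= l ->
    (forall i, i < l.*2 -> f i \in layer j) ->
    (forall i, i.+1 < l.*2 -> (key j (f i.+1) < key j (f i)) && e (f i) (f i.+1)) ->
  exists s, [/\ size s = l.*2.+1, uniq s & cycle e s].
Proof.
case/andP=> j0 jl fj fS.
have fle a b : a <= b -> b < l.*2 -> key j (f b) <= key j (f a).
  move/subnK<-; elim: (b - a) => [|d IHd] // lt.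
  have /andP[/ltnW lek _] := fS (d + a) lt.
  by apply: leq_trans lek (IHd _); apply: ltnW.
have flt a b : a < b -> b < l.*2 -> key j (f b) < key j (f a).
  move=> ab bl; have /andP[lta _] := fS a (leq_ltn_trans ab bl).
  exact: leq_ltn_trans (fle _ _ ab bl) lta.
have l0 : 0 < l by apply: leq_trans jl.
(* index of the last vertex of the chain *)
pose z := l.*2.-1.
have zl : z < l.*2 by rewrite /z; lia.
have z0 : 0 < z by rewrite /z; lia.
pose same t a b := key j (f a) %/ #|V| ^ t == key j (f b) %/ #|V| ^ t.
have ext : exists t, same t 0 z.
  by exists j; rewrite /same !key_root ?fj //; lia.
case: (ex_minnP ext) => [[|t]] sT minT.
  by move: sT; rewrite /same !divn1 gtn_eqF // flt.
have tj : t < j.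
  by apply: minT; rewrite /same !key_root ?fj //; lia.
have nsame : ~~ same t 0 z by apply/negP => /minT; rewrite ltnn.
have [s sz ns] : exists2 s, s < z & ~~ same t s s.+1.
  have : ~~ [forall s : 'I_z, same t s s.+1].
    apply: contra nsame => /forallP sm.
    have : forall b, b <= z -> same t 0 b.
      elim=> [|b IHb] bz; first by rewrite /same.
      by move: (IHb (ltnW bz)) (sm (Ordinal bz)); rewrite /same => /eqP->.
    by apply.
  by case/forallPn => s ns; exists s.
pose L := l.*2.+1 - t.+1.*2.
pose p := minn s (z - L).
have pz : p + L <= z by rewrite /p /L /z; lia.
have ps : p <= s by rewrite /p geq_minl.
have sp : s < p + L by rewrite /p /L /z; lia.
have mdiv u a b : a <= b -> b <= z -> key j (f b) %/ #|V| ^ u <= key j (f a) %/ #|V| ^ u.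
  by move=> ab bz; apply: leq_div2r; apply: fle => //; lia.
have squeeze (a b c d : nat) : b <= a -> c <= b -> d <= c -> a == d -> c == b.
  by lia.
have nsp : ~~ same t (p + L) p.
  have h1 := mdiv t p s ps (ltnW sz); have h2 := mdiv t s.+1 (p + L) sp pz.
  have h3 := mdiv t s s.+1 (leqnSn _) sz.
  by apply: contra ns => eqp; rewrite /same eq_sym; apply: squeeze h1 h3 h2 _; rewrite eq_sym.
have spp : same t.+1 (p + L) p.
  have h1 := mdiv t.+1 0 p (leq0n _) (leq_trans (leq_addr _ _) pz).
  have h2 := mdiv t.+1 (p + L) z pz (leqnn _).
  have h3 := mdiv t.+1 p (p + L) (leq_addr _ _) pz.
  exact: squeeze h1 h3 h2 sT.
have fin i : i <= z -> f i \in layer j by move=> iz; apply: fj; lia.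
have [|q [szq uq qb qp]] := tree_path tj (fin _ pz) (fin p _) nsp (eqP spp).
  by lia.
pose w := [seq f i | i <- iota p.+1 L].
have fpath d a : a + d <= z -> path e (f a) [seq f i | i <- iota a.+1 d].
  elim: d a => [|d IHd] a //= lead.
  have /andP[_ ->] := fS a ltac:(lia).
  by apply: IHd; lia.
have lastw : last (f p) w = f (p + L).
  by rewrite /w last_map; congr f; elim: (L) (p) => [|d IHd] a /=; rewrite ?IHd; lia.
exists (f p :: w ++ q); split.
- by rewrite /= size_cat size_map size_iota szq /L; lia.
- rewrite -cat_cons cat_uniq uq andbT.
  have -> : f p :: w = [seq f i | i <- iota p L.+1] by [].
  apply/andP; split.
    rewrite map_inj_in_uniq ?iota_uniq // => a b; rewrite !mem_iota => ha hb fab.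
    have [ab|ba|//] := ltngtP a b.
      by have := flt _ _ ab ltac:(lia); rewrite fab ltnn.
    by have := flt _ _ ba ltac:(lia); rewrite fab ltnn.
  apply/hasPn => x /qb xb; apply: contraL xb => /mapP[i].
  rewrite mem_iota => hi ->; apply: (@layer_out _ j); first by lia.
  by apply: fin; lia.
- by rewrite /= rcons_cat cat_path lastw qp andbT; apply: fpath; lia.
Qed.

(** The ends of the monotone paths with [m] edges: peeling off the vertices that
end no longer path yields the greedy colouring of Gallai and Roy, without having
to speak of the length of a longest path. *)
Fixpoint descending (k : V -> nat) (S : {set V}) (m : nat) : {set V} :=
  if m is m'.+1 then
    [set x in descending k S m' | [exists y in descending k S m', e x y && (k y < k x)]]
  else S.

Lemma descending_chain k S m x : x \in descending k S m ->
  exists f : nat -> V, [/\ f 0 = x, forall i, i <= m -> f i \in S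
    & forall i, i < m -> (k (f i.+1) < k (f i)) && e (f i) (f i.+1)].
Proof.
elim: m x => [|m IHm] x /=.
  by move=> xS; exists (fun _ => x); split=> // i; rewrite leqn0.
rewrite inE => /andP[xm /exists_inP[y ym /andP[exy kyx]]].
have [f [f0 fS fe]] := IHm y ym.
exists (fun i => if i is i'.+1 then f i' else x); split=> // [[|i]|[|i]] //.
- move=> _; have [g [<- gS _]] := IHm x xm; exact: gS.
- by move=> /fS.
- by rewrite f0 kyx exy.
- by move=> /fe.
Qed.

Local Open Scope ring_scope.

(** The successive differences of the sets [descending k S s] are independent, for
an edge inside one of them would put its upper end into the next set. *)
Lemma heavy_independent (F : realDomainType) (w : V -> F) (k : V -> nat) (S : {set V}) m :
    injective k -> (forall x, 0 <= w x) -> descending k S m = set0 ->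
  exists I : {set V}, [/\ I \subset S, {in I &, forall x y, ~~ e x y}
    & \sum_(x in S) w x <= m%:R * \sum_(x in I) w x].
Proof.
move=> kinj w0 Dm.
pose D := descending k S; pose I s := D s :\: D s.+1.
have DS s : D s.+1 \subset D s by apply/subsetP => x; rewrite /D /= inE => /andP[].
have sumI s : \sum_(x in D s) w x = \sum_(x in I s) w x + \sum_(x in D s.+1) w x.
  by rewrite (big_setID (D s.+1)) /= (setIidPr (DS s)) addrC.
have sumS d : \sum_(x in S) w x =
    \sum_(s < d) \sum_(x in I s) w x + \sum_(x in D d) w x.
  elim: d => [|d IHd]; first by rewrite big_ord0 add0r.
  by rewrite big_ord_recr /= -addrA -sumI.
have IS s : I s \subset S.
  rewrite /I; apply: subset_trans (subsetDl _ _) _.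
  by elim: s => [|s IHs] //; apply: subset_trans (DS s) IHs.
have Iind s : {in I s &, forall x y, ~~ e x y}.
  move=> x y; rewrite !in_setD => /andP[xn xs] /andP[yn ys]; apply/negP => exy.
  have nxy : x != y by apply: contraTneq exy => ->; rewrite e_irr.
  have [kxy|kyx|/kinj/eqP] := ltngtP (k x) (k y); last by rewrite (negPf nxy).
    case/negP: yn; rewrite /D /= inE -/(D s) ys.
    by apply/exists_inP; exists x; rewrite // e_sym exy.
  by case/negP: xn; rewrite /D /= inE -/(D s) xs; apply/exists_inP; exists y; rewrite // exy.
have := sumS m; rewrite [D m]Dm big_set0 addr0 => eqS.
case: (pickP (fun s : 'I_m =>
         \sum_(x in S) w x <= m%:R * \sum_(x in I s) w x)) => [s le_s|no].
  by exists (I s); split.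
exists set0; rewrite sub0set big_set0 mulr0; split=> //; first by move=> x y; rewrite in_set0.
case: m no eqS {Dm} => [|m] no eqS; first by rewrite eqS big_ord0.
suff : \sum_(s < m.+1) m.+1%:R * \sum_(x in I s) w x < \sum_(s < m.+1) \sum_(x in S) w x.
  by rewrite -mulr_sumr -eqS sumr_const card_ord mulr_natl ltxx.
apply: ltr_sum => [|s _]; first by apply/hasP; exists ord0; rewrite // mem_index_enum.
by rewrite ltNge no.
Qed.

Lemma layer_heavy_independent (F : realDomainType) (w : V -> F) l j :
    (0 < j <= l)%N -> (forall x, 0 <= w x) ->
    (forall s, size s = l.*2.+1 -> uniq s -> ~~ cycle e s) ->
  exists I : {set V}, [/\ I \subset layer j, {in I &, forall x y, ~~ e x y}
    & \sum_(x in layer j) w x <= (2 * l%:R - 1) * \sum_(x in I) w x].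
Proof.
move=> jl w0 nocyc; have l0 : (0 < l)%N by case/andP: jl => /leq_trans h /h.
have -> : 2 * l%:R - 1 = (l.*2.-1)%:R :> F.
  by rewrite -subn1 natrB ?double_gt0 // -mul2n natrM.
apply: (heavy_independent (@key_inj j) w0).
apply/eqP; apply: contraT => /set0Pn[x /descending_chain[f [_ fS fe]]].
have [i il|i il|s [szs us cs]] := @layer_chain_cycle l j f jl.
- by apply: fS; lia.
- by apply: fe; lia.
- by have := nocyc s szs us; rewrite cs.
Qed.

End Layers.

(** * The weighted induction on colour lists *)

(** The recurrence factors as (T - q)(T - 1/q), so the differences
y (j+1) - y j / q are multiplied by at least q at each step. *)
Lemma layer_growth (F : realFieldType) (y : nat -> F) (q : F) l : 0 < q ->
    (forall j, (j.+1 < l)%N ->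
       (q + 1 + q^-1) * y j.+1 <= y j + y j.+1 + y j.+2) ->
  forall j, (j < l)%N -> q ^+ j * (y 1%N - y 0%N / q) <= y j.+1 - y j / q.
Proof.
move=> q0 yS; elim=> [|j IHj] jl; first by rewrite expr0 mul1r.
have := IHj (ltnW jl); rewrite -(ler_pM2l q0) mulrA -exprS => /le_trans; apply.
have := yS j jl.
have -> : q * (y j.+1 - y j / q) = q * y j.+1 - y j by field; rewrite gt_eqF.
have -> : y j.+1 / q = q^-1 * y j.+1 by rewrite mulrC.
by lra.
Qed.

Section ListWeights.
Variables (F : realFieldType) (l : nat) (X : nat -> F).

(** The number of vertices that lists of [a] colours will be shown to allow; the
bound on the Ramsey number is [capacity k] + 1. *)
Definition capacity (a : nat) : F := \prod_(b < a) ((2 * l%:R - 1) * X b.+1).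

Definition list_weight (a : nat) : F := (capacity a)^-1.

Variables (V C : finType) (c : V -> V -> C).

Definition admissible (U : {set V}) (L : V -> {set C}) : Prop :=
  {in U &, forall x y, x != y -> c x y \in L x}.

Definition color_graph (U : {set V}) (i : C) : rel V :=
  fun x y => [&& x \in U, y \in U, x != y & c x y == i].

Definition relist (L : V -> {set C}) (I : {set V}) (i : C) (x : V) : {set C} :=
  if x \in I then L x :\ i else L x.

(** [X_large] is the inequality that the geometric growth of the layers
contradicts.  Its last factor is close to 1 and accounts for the weight of the
starting vertex itself. *)
Variables (q : nat -> F).
Hypotheses (l_ge2 : (2 <= l)%N)
  (c_sym : forall x y, c x y = c y x)
  (c_nocycle : forall i s, size s = l.*2.+1 -> uniq s ->
     ~~ cycle (fun x y => c x y == i) s)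
  (q_gt0 : forall a, 0 < q a.+1)
  (X_def : forall a, X a.+1 = q a.+1 + 1 + (q a.+1)^-1)
  (X_mono : forall a b, (a <= b)%N -> X a.+1 <= X b.+1)
  (capacity_ge1 : forall a, 1 <= capacity a)
  (X_large : forall a, a.+1%:R <= X a.+1 * q a.+1 ^+ l.-1 *
     (1 - list_weight a.+1 - a.+1%:R * list_weight a.+1 / q a.+1)).

Lemma X_gt0 a : 0 < X a.+1.
Proof.
have := q_gt0 a; have : 0 < (q a.+1)^-1 by rewrite invr_gt0.
by rewrite X_def; lra.
Qed.

Lemma list_weight_gt0 a : 0 < list_weight a.
Proof. by rewrite invr_gt0; apply: lt_le_trans (capacity_ge1 a). Qed.

Lemma list_weight_le1 a : list_weight a <= 1.
Proof. by rewrite invf_le1 //; apply: lt_le_trans (capacity_ge1 a). Qed.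

Lemma base_gt0 : 0 < 2 * l%:R - 1 :> F.
Proof.
have : 2%:R <= l%:R :> F by rewrite ler_nat.
by lra.
Qed.

Lemma list_weightS a :
  list_weight a = (2 * l%:R - 1) * X a.+1 * list_weight a.+1.
Proof.
rewrite /list_weight /capacity big_ord_recr /= invfM mulrCA mulfV ?mulr1 //.
by rewrite gt_eqF // mulr_gt0 ?base_gt0 ?X_gt0.
Qed.

Lemma color_graph_sym U i : symmetric (color_graph U i).
Proof. by move=> x y; rewrite /color_graph c_sym eq_sym andbCA. Qed.

Lemma color_graph_irr U i : irreflexive (color_graph U i).
Proof. by move=> x; rewrite /color_graph eqxx !andbF. Qed.

Lemma color_graph_nocycle U i s : size s = l.*2.+1 -> uniq s ->
  ~~ cycle (color_graph U i) s.
Proof.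
move=> szs us; apply: contra (c_nocycle i szs us).
by apply: sub_cycle => x y /and4P[].
Qed.

Lemma layer_in (U : {set V}) i v j x : v \in U -> x \in layer (color_graph U i) v j -> x \in U.
Proof.
move=> vU; case: j => [|j]; first by rewrite inE => /eqP->.
by case/layer_pred=> y _ /and4P[].
Qed.

Lemma layer_color U i v j x L : admissible U L ->
  x \in layer (color_graph U i) v j.+1 -> i \in L x.
Proof.
move=> adm; case/layer_pred=> y _ /and4P[yU xU nyx /eqP<-].
by rewrite c_sym; apply: adm => //; rewrite eq_sym.
Qed.

Definition weight (L : V -> {set C}) (A : {set V}) : F := \sum_(x in A) list_weight #|L x|.

Lemma weight_ge0 L A : 0 <= weight L A.
Proof. by apply: sumr_ge0 => x _; apply/ltW/list_weight_gt0. Qed.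

Lemma weight_sub L (A B : {set V}) : A \subset B -> weight L A <= weight L B.
Proof.
move=> sAB; rewrite /weight [leRHS](big_setID A) /= (setIidPr sAB) lerDl.
exact: weight_ge0.
Qed.

Lemma weightU L (A B : {set V}) : weight L (A :|: B) <= weight L A + weight L B.
Proof.
rewrite /weight (big_setID A) /= setUK [_ :\: A]setDUl setDv set0U lerD2l.
by apply: weight_sub; apply: subsetDl.
Qed.

(** Losing colour [i] multiplies the weight of a vertex by at least
(2l-1) X (a+1), since its list has at least [a.+1] colours, and the independent set keeps a fraction 1/(2l-1) of its layer. *)
Lemma relist_weight (U : {set V}) L i v j a : admissible U L -> v \in U ->
    (forall x, x \in U -> (a < #|L x|)%N) -> (0 < j <= l)%N ->
  exists I : {set V}, [/\ I \subset layer (color_graph U i) v j,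
    {in I &, forall x y, ~~ color_graph U i x y}
    & X a.+1 * weight L (layer (color_graph U i) v j) <= weight (relist L I i) I].
Proof.
move=> adm vU La jl.
have [I [sI indI]] := layer_heavy_independent v (color_graph_sym U i)
  (@color_graph_irr U i) jl (fun x => ltW (list_weight_gt0 #|L x|.-1))
  (@color_graph_nocycle U i).
set S := layer _ _ _ in sI *; move=> heavy; exists I; split=> //.
case: j jl @S sI heavy => // j jl S sI heavy.
rewrite -(ler_pM2l base_gt0).
have -> : weight (relist L I i) I = \sum_(x in I) list_weight #|L x|.-1.
  apply: eq_bigr => x xI; rewrite /relist xI (cardsD1 i (L x)).
  by rewrite (layer_color adm (subsetP sI x xI)).
apply: le_trans heavy; rewrite /weight !mulr_sumr; apply: ler_sum => x xS.
have : (a < #|L x|)%N by apply: La; apply: layer_in xS.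
case: #|L x| => // b ab; rewrite [leRHS]list_weightS mulrA.
rewrite ler_pM2r ?list_weight_gt0 // ler_pM2l ?base_gt0 //.
exact: X_mono.
Qed.

Lemma relist_admissible (U W : {set V}) L (I : {set V}) i :
    admissible U L -> W \subset U -> I \subset W ->
    (forall x y, x \in I -> y \in W -> ~~ color_graph U i x y) ->
  admissible W (relist L I i).
Proof.
move=> adm sWU sIW noI x y xW yW nxy; rewrite /relist.
have xU := subsetP sWU x xW; have yU := subsetP sWU y yW.
case: ifP => xI; last exact: adm.
rewrite !inE adm // andbT; have := noI x y xI yW.
by rewrite /color_graph xU yU nxy.
Qed.

(** The induction measure adds one to each list length, so that it decreases both
when a vertex is discarded and when a vertex loses a colour. *)
Lemma list_weight_sum U L : admissible U L -> weight L U <= 1.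
Proof.
have [N] := ubnP (\sum_(x in U) #|L x|.+1)%N.
elim: N U L => // N IHN U L; rewrite ltnS => leN adm.
have {IHN} IH (W : {set V}) (K : V -> {set C}) :
    (\sum_(x in W) #|K x|.+1 < \sum_(x in U) #|L x|.+1)%N ->
    admissible W K -> weight K W <= 1.
  by move=> ltW; apply: IHN; apply: leq_trans ltW leN.
have [->|[v0 v0U]] := set_0Vmem U; first by rewrite /weight big_set0 ler01.
have [v vU vmin] := arg_minnP (fun x => #|L x|) v0U.
have {}vU : v \in U := vU.
rewrite leNgt; apply/negP => big.
have sumU : weight L U = list_weight #|L v| + weight L (U :\ v).
  by rewrite /weight (big_setD1 v).
have W0 : 0 < weight L (U :\ v).
  by have := list_weight_le1 #|L v|; lra.
have Lc x : x \in U :\ v -> c v x \in L v.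
  by rewrite !inE => /andP[nxv xU]; apply: adm; rewrite // eq_sym.
(* the weight outside v is positive, so v has an edge and a nonempty list *)
have [a Ea] : exists a, #|L v| = a.+1.
  have [Lv0|Lv0] := posnP #|L v|; last by exists #|L v|.-1; rewrite prednK.
  move: W0; rewrite /weight big1 ?ltxx // => x /Lc.
  by rewrite (cards0_eq Lv0) inE.
set y0 := list_weight #|L v| in sumU.
have [i iL ybig] : exists2 i, i \in L v &
    1 - y0 < a.+1%:R * weight L (layer (color_graph U i) v 1).
  have Ew : weight L (U :\ v) =
      \sum_(i in L v) weight L (layer (color_graph U i) v 1).
    rewrite /weight (partition_big (c v) (mem (L v))) //=.
    apply: eq_bigr => i _; apply: eq_bigl => x; rewrite !inE.
    have [->|nxv] /= := eqVneq x v; first by [].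
    apply/andP/exists_inP => [[xU cvx]|[z /[!inE] /eqP-> /and4P[_ xU _ cvx] //]].
    by exists v; rewrite ?inE //; apply/and4P; rewrite eq_sym.
  apply/exists_inP; apply: contraT => /exists_inPn no.
  have : a.+1%:R * weight L (U :\ v) <= a.+1%:R * (1 - y0).
    have -> : a.+1%:R * (1 - y0) = \sum_(i in L v) (1 - y0).
      by rewrite sumr_const Ea mulr_natl.
    by rewrite Ew mulr_sumr; apply: ler_sum => i iL; rewrite leNgt no.
  by rewrite ler_pM2l ?ltr0Sn //; move: big; rewrite sumU; lra.
pose e := color_graph U i; pose y j := weight L (layer e v j).
have La x : x \in U -> (a < #|L x|)%N by move=> xU; rewrite -Ea; apply: vmin.
have inU j : layer e v j \subset U by apply/subsetP => x; apply: layer_in.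
(* the last layer, relisted on its own, is a smaller configuration *)
have yl : X a.+1 * y l <= 1.
  have [|I [sI indI leI]] := relist_weight (j := l) i adm vU La.
    by rewrite leqnn andbT; apply: leq_trans l_ge2.
  have sIU := subset_trans sI (inU l).
  apply: le_trans leI (IH _ _ _ _); last exact: relist_admissible adm sIU _ _.
  rewrite [ltnRHS](big_setID I) /= (setIidPr sIU) -addn1 leq_add //.
    apply: leq_sum => x xI; rewrite ltnS; apply: subset_leq_card.
    by rewrite /relist xI subD1set.
  rewrite (bigD1 v) ?addSn //= inE vU andbT.
  apply/negP => /(subsetP sI) vl; have /negP[] := @layer_out _ e v 0 l v (ltnW l_ge2) vl.
  by rewrite inE.
(* otherwise replacing the three layers by I would increase the total weight *)
have yS j : (j.+1 < l)%N ->
    (q a.+1 + 1 + (q a.+1)^-1) * y j.+1 <= y j + y j.+1 + y j.+2.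
  move=> jl; rewrite -X_def leNgt; apply/negP => good.
  have [|I [sI indI leI]] := relist_weight (j := j.+1) i adm vU La.
    exact: ltnW.
  rewrite -/e -/(y j.+1) in sI indI leI.
  pose D := layer e v j :|: layer e v j.+1 :|: layer e v j.+2.
  have sD : D \subset U by rewrite !subUset !inU.
  have sID : I \subset D.
    by apply: subset_trans sI _; rewrite /D [_ :|: layer e v j.+1]setUC -setUA subsetUl.
  have disj : [disjoint U :\: D & I].
    by rewrite disjoints_subset setDE (subset_trans (subsetIr _ _)) // setCS.
  pose W := (U :\: D) :|: I.
  have sW : W \subset U by rewrite subUset subsetDl (subset_trans sID).
  have relD x : x \in U :\: D -> relist L I i x = L x.
    by move=> xD; rewrite /relist (disjointFr disj xD).
  have admW : admissible W (relist L I i).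
    apply: relist_admissible adm sW (subsetUr _ _) _ => x z xI; rewrite inE.
    case/orP=> [|zI]; last exact: indI.
    rewrite inE => /andP[zD _]; apply: contra zD => exz.
    by apply: (layer_neighbor (color_graph_sym U i) (subsetP sI x xI)).
  have yD : weight L D <= y j + y j.+1 + y j.+2.
    by apply: le_trans (weightU _ _ _) _; rewrite lerD2r; apply: weightU.
  have [x xD] : exists x, x \in D.
    have : 0 < X a.+1 * y j.+1.
      by apply: le_lt_trans good; rewrite !addr_ge0 // weight_ge0.
    case: (set_0Vmem (layer e v j.+1)) => [E|[x xl _]].
      by rewrite /y E /weight big_set0 mulr0 ltxx.
    by exists x; rewrite !in_setU xl orbT.
  have : weight (relist L I i) W <= 1.
    apply: IH admW; rewrite [ltnRHS](big_setID D) /= (setIidPr sD).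
    rewrite [ltnLHS](eq_bigl [predU U :\: D & I]); last by move=> z; rewrite !inE.
    rewrite bigU //= addnC -addSn leq_add //; last first.
      by apply: leq_sum => z zD; rewrite relD.
    rewrite [leqRHS](big_setID I) /= (setIidPr sID).
    have sumI : (\sum_(x in I) #|relist L I i x|.+1 = \sum_(x in I) #|L x|)%N.
      apply: eq_bigr => z zI; rewrite /relist zI [RHS](cardsD1 i).
      by rewrite (layer_color adm (subsetP sI z zI)).
    rewrite sumI.
    have [xI|xI] := boolP (x \in I).
      apply: leq_trans (leq_addr _ _); rewrite (bigD1 x) // [leqRHS](bigD1 x) //=.
      by rewrite addSn ltnS leq_add2l; apply: leq_sum => z _; apply: leqnSn.
    rewrite -addn1 leq_add //; first by apply: leq_sum => z _; apply: leqnSn.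
    by rewrite (bigD1 x) ?addSn //= inE xI.
  have -> : weight (relist L I i) W = weight L (U :\: D) + weight (relist L I i) I.
    rewrite {1}/weight (eq_bigl [predU U :\: D & I]); last by move=> z; rewrite !inE.
    by rewrite bigU //=; congr (_ + _); apply: eq_bigr => z zD; rewrite relD.
  have : weight L U = weight L D + weight L (U :\: D).
    by rewrite {1}/weight (big_setID D) /= (setIidPr sD).
  by move: big leI good yD; rewrite -/(y _); lra.
have q0 := q_gt0 a.
have := layer_growth q0 yS (j := l.-1) ltac:(lia).
rewrite prednK ?(ltnW l_ge2) //.
have Ey0 : y 0%N = y0 by rewrite /y /weight big_set1.
rewrite Ey0 => grow.
have {}grow : q a.+1 ^+ l.-1 * (y 1%N - y0 / q a.+1) <= y l.
  apply: le_trans grow _; rewrite gerDl oppr_le0 divr_ge0 ?(ltW q0) //.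
  exact: weight_ge0.
have XQ : 0 < X a.+1 * q a.+1 ^+ l.-1 by rewrite mulr_gt0 ?X_gt0 ?exprn_gt0.
have := X_large a; rewrite -Ea -/y0 leNgt Ea => /negP; apply.
apply: (@lt_le_trans _ _ (X a.+1 * q a.+1 ^+ l.-1 *
    (a.+1%:R * (y 1%N - y0 / q a.+1)))).
  rewrite ltr_pM2l // mulrBr mulrA ltrD2r //.
rewrite mulrCA -[leRHS]mulr1 ler_pM2l ?ltr0Sn //.
by apply: le_trans yl; rewrite -mulrA ler_pM2l ?X_gt0.
Qed.

End ListWeights.

(** * The choice of the growth rate *)

Lemma bernoulli (F : realFieldType) (y : F) m : 0 <= y -> 1 + m%:R * y <= (1 + y) ^+ m.
Proof.
move=> y0; elim: m => [|m IHm]; first by rewrite mul0r addr0 expr0.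
rewrite exprS; apply: le_trans (ler_wpM2l _ IHm); last by lra.
have : 0 <= m%:R * (y * y) by rewrite !mulr_ge0.
by rewrite -[m.+1]addn1 natrD; lra.
Qed.

Lemma expr1D_le_quadratic (F : realFieldType) (y : F) m : 0 <= y -> m%:R * y <= 1 ->
  (1 + y) ^+ m <= 1 + m%:R * y + (m%:R * y) ^+ 2.
Proof.
move=> y0; elim: m => [|m IHm]; first by rewrite mul0r expr0 expr0n !addr0.
rewrite -[m.+1]addn1 natrD mulrDl mul1r => my.
have m0 : 0 <= m%:R * y by rewrite mulr_ge0.
rewrite addn1 exprS; apply: le_trans (ler_wpM2l _ (IHm _)) _; [lra | lra |].
set z := m%:R * y in m0 my *.
have : 0 <= (1 - z) * (y * z) by rewrite !mulr_ge0 //; lra.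
have : 0 <= y * y by rewrite mulr_ge0.
by rewrite !expr2; lra.
Qed.

Lemma addV_mono (F : realFieldType) (x y : F) : 1 <= x -> x <= y -> x + x^-1 <= y + y^-1.
Proof.
move=> x1 xy; rewrite -subr_ge0.
have -> : y + y^-1 - (x + x^-1) = (y - x) * (x * y - 1) / (x * y).
  by field; rewrite !gt_eqF //; lra.
rewrite divr_ge0 ?mulr_ge0 ?subr_ge0 //; try lra.
by rewrite -[leLHS]mulr1 ler_pM //; lra.
Qed.

Section GrowthRate.
Variables (R : realType) (l : nat).
Hypothesis l_ge2 : (2 <= l)%N.

Definition root_l (a : nat) : R := powR a%:R (l%:R^-1).
(** Since X q ^ (l-1) = q ^ l + q ^ (l-1) + q ^ (l-2) has to exceed [a], [q] is
a ^ (1/l) - 1/l up to lower order terms; the term 1 / a ^ (1/l) gives the slack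
needed uniformly for all [a] >= 1 and only costs an O(a ^ (-2/l)) relative error. *)
Definition layer_growth_rate (a : nat) : R := root_l a - l%:R^-1 + (root_l a)^-1.
Definition layer_loss (a : nat) : R :=
  layer_growth_rate a + 1 + (layer_growth_rate a)^-1.
Notation q := layer_growth_rate.
Notation X := layer_loss.
Notation g := (capacity l layer_loss).

Lemma l_inv : 0 < l%:R^-1 :> R /\ l%:R^-1 <= 2^-1 :> R.
Proof.
have l2 : 2%:R <= l%:R :> R by rewrite ler_nat.
by split; rewrite ?invr_gt0 ?lef_pV2 ?posrE //; lra.
Qed.

Lemma root_lX a : root_l a ^+ l = a%:R.
Proof.
rewrite -powR_mulrn ?powR_ge0 // -powRrM mulVf ?powRr1 //.
by rewrite pnatr_eq0; lia.
Qed.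

Lemma root_l_mono a b : (a <= b)%N -> root_l a <= root_l b.
Proof.
by move=> ab; apply: ge0_ler_powR; rewrite ?nnegrE ?ler_nat // invr_ge0.
Qed.

Lemma root_l_ge1 a : 1 <= root_l a.+1.
Proof. by apply: le_trans (@root_l_mono 1 a.+1 _); rewrite // /root_l powR1. Qed.

Lemma rate_ge1 a : 1 <= q a.+1.
Proof.
have [_ l2] := l_inv; have := addV_mono (lexx _) (root_l_ge1 a).
by rewrite invr1 /layer_growth_rate; lra.
Qed.

Lemma rate_gt0 a : 0 < q a.+1.
Proof. exact: lt_le_trans ltr01 (rate_ge1 a). Qed.

Lemma loss_ge2 a : 2 <= X a.+1.
Proof.
have := rate_ge1 a; have : 0 < (q a.+1)^-1 by rewrite invr_gt0 rate_gt0.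
by rewrite /layer_loss; lra.
Qed.

Lemma loss_mono a b : (a <= b)%N -> X a.+1 <= X b.+1.
Proof.
move=> ab; have qab : q a.+1 <= q b.+1.
  have := addV_mono (root_l_ge1 a) (@root_l_mono a.+1 b.+1 ab).
  by rewrite /layer_growth_rate; lra.
by have := addV_mono (rate_ge1 a) qab; rewrite /layer_loss; lra.
Qed.

Lemma capacityS a : g a.+1 = g a * ((2 * l%:R - 1) * X a.+1).
Proof. by rewrite /capacity big_ord_recr. Qed.

(** A crude bound, enough for the weight of the starting vertex to be absorbed in
the slack of [loss_power]. *)
Lemma capacity_quadratic a : a.+1%:R ^+ 2 <= g a.
Proof.
elim: a => [|a IHa]; first by rewrite /capacity big_ord0 expr1n.
have l2 : 2%:R <= l%:R :> R by rewrite ler_nat.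
rewrite capacityS; have a0 : 0 <= a%:R :> R by [].
have X2 := loss_ge2 a.
have fac : 4 <= (2 * l%:R - 1) * X a.+1 by nra.
apply: (@le_trans _ _ (a.+1%:R ^+ 2 * 4)); last by apply: ler_pM; rewrite ?exprn_ge0.
rewrite -[a.+2]addn2 -[a.+1]addn1 !natrD; nra.
Qed.

(** With s = a ^ (1/l), both sides are compared to (s + 1/s) ^ l = (q + 1/l) ^ l:
Bernoulli bounds it below by s ^ l + l s ^ (l-2), and the quadratic bound on
(1 + 1/(lq)) ^ l bounds it above by q ^ l + q ^ (l-1) + q ^ (l-2). *)
Lemma loss_power a : a.+1%:R + 1 <= X a.+1 * q a.+1 ^+ l.-1.
Proof.
have [li0 li2] := l_inv; have s1 := root_l_ge1 a; have q1 := rate_ge1 a.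
have q0 := rate_gt0 a; set s := root_l a.+1 in s1; set Q := q a.+1 in q1 q0 *.
have s0 : 0 < s by lra.
have l0 : l%:R != 0 :> R by rewrite pnatr_eq0; lia.
have upper : (s + s^-1) ^+ l <= X a.+1 * Q ^+ l.-1.
  have -> : s + s^-1 = Q * (1 + l%:R^-1 / Q).
    have -> : Q * (1 + l%:R^-1 / Q) = Q + l%:R^-1 by field; rewrite l0 gt_eqF.
    by rewrite /Q /layer_growth_rate -/s; lra.
  have Ey : l%:R * (l%:R^-1 / Q) = Q^-1 by rewrite mulrA mulfV ?mul1r.
  rewrite exprMn; apply: le_trans (ler_wpM2l _ (expr1D_le_quadratic _ _)) _.
  - by rewrite exprn_ge0 // ltW.
  - by rewrite divr_ge0 // ltW.
  - by rewrite Ey invf_le1.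
  rewrite Ey -{1}(prednK (ltnW l_ge2)) exprS /layer_loss -/Q.
  by rewrite le_eqVlt; apply/predU1P; left; field; rewrite gt_eqF.
apply: le_trans upper.
have -> : s + s^-1 = s * (1 + s^-1 ^+ 2) by field; rewrite gt_eqF.
rewrite exprMn; apply: le_trans (ler_wpM2l _ (bernoulli _ _)); last 2 first.
- by rewrite exprn_ge0 // ltW.
- by rewrite exprn_ge0 // invr_ge0 ltW.
rewrite mulrDr mulr1 root_lX lerD2l.
have -> : a.+1%:R = s ^+ 2 * s ^+ (l - 2) by rewrite -exprD subnKC ?root_lX.
have -> : s ^+ 2 * s ^+ (l - 2) * (l%:R * s^-1 ^+ 2) = l%:R * s ^+ (l - 2).
  by field; rewrite gt_eqF.
rewrite -[leLHS]mulr1; apply: ler_pM; rewrite ?ler01 ?exprn_ege1 //.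
by rewrite ler1n; lia.
Qed.

Lemma loss_large a : a.+1%:R <= X a.+1 * q a.+1 ^+ l.-1 *
  (1 - list_weight l X a.+1 - a.+1%:R * list_weight l X a.+1 / q a.+1).
Proof.
have q1 := rate_ge1 a; have P := loss_power a; set T := X _ * _ in P *.
have gq := capacity_quadratic a.+1; set G := g a.+1 in gq *.
set A : R := a.+1%:R in P *; have A0 : 0 < A by rewrite /A ltr0Sn.
have {}gq : (A + 1) ^+ 2 <= G by rewrite /A natr1.
have w : list_weight l X a.+1 <= (A + 1) ^- 2.
  rewrite /list_weight lef_pV2 // posrE ?exprn_gt0 //; try lra.
  by apply: lt_le_trans gq; rewrite exprn_gt0 //; lra.
set W := list_weight _ _ _ in w *.
have W0 : 0 <= W by rewrite invr_ge0; apply: le_trans gq; rewrite exprn_ge0 //; lra.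
have AWq : A * W / q a.+1 <= A * W.
  by rewrite ler_pdivrMr ?rate_gt0 // ler_peMr // mulr_ge0 // ltW.
have AW : (A + 1) * W <= (A + 1)^-1.
  apply: le_trans (ler_wpM2l _ w) _; first by lra.
  by rewrite le_eqVlt; apply/predU1P; left; field; rewrite gt_eqF //; lra.
have A1 : 0 < (A + 1)^-1 by rewrite invr_gt0; lra.
have E : (A + 1) * (1 - (A + 1)^-1) = A by field; rewrite gt_eqF //; lra.
rewrite -{1}E; apply: ler_pM => //; try lra.
by rewrite subr_ge0 invf_le1; lra.
Qed.

Lemma loss_le a : X a.+1 <= root_l a.+1 *
  expR ((1 - l%:R^-1) * (root_l a.+1)^-1 + 3 * (root_l a.+1) ^- 2).
Proof.
have [li0 li2] := l_inv; have s1 := root_l_ge1 a; set s := root_l a.+1 in s1 *.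
have s0 : 0 < s by lra.
have l0 : l%:R != 0 :> R by rewrite pnatr_eq0; lia.
have qs : (q a.+1)^-1 <= 2 / s.
  rewrite -[2 / s]invrK lef_pV2 ?posrE ?rate_gt0 ?invr_gt0 ?divr_gt0 //.
  rewrite invf_div /layer_growth_rate -/s.
  have si0 : 0 < s^-1 by rewrite invr_gt0.
  by lra.
apply: le_trans (ler_wpM2l (ltW s0) (expR_ge1Dx _)).
have -> : s * (1 + ((1 - l%:R^-1) / s + 3 * s ^- 2)) = s + (1 - l%:R^-1) + s^-1 + 2 / s.
  by rewrite expr2; field; rewrite l0 gt_eqF.
by rewrite /layer_loss {1}/layer_growth_rate -/s; lra.
Qed.

Lemma capacity_le k : g k <= (2 * l%:R - 1) ^+ k * powR k`!%:R (l%:R^-1) *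
  expR (\sum_(a < k)
     ((1 - l%:R^-1) * (root_l a.+1)^-1 + 3 * (root_l a.+1) ^- 2)).
Proof.
elim: k => [|k IHk].
  by rewrite /capacity !big_ord0 expR0 fact0 powR1 expr0 !mulr1.
have l2 : 2%:R <= l%:R :> R by rewrite ler_nat.
have b0 : 0 <= 2 * l%:R - 1 :> R by lra.
rewrite capacityS big_ord_recr /= expRD exprSr factS mulnC natrM powRM ?ler0n //.
rewrite -/(root_l k.+1).
have := ler_pM _ _ IHk (ler_wpM2l b0 (loss_le k)).
rewrite mulr_ge0 //; last by apply: le_trans (loss_ge2 k); lra.
rewrite (le_trans _ (capacity_quadratic k)) ?exprn_ge0 // => /(_ isT isT) /le_trans; apply.
by rewrite le_eqVlt; apply/predU1P; left; ring.
Qed.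

End GrowthRate.

(** * Asymptotics of the product *)

(** Young's inequality for x ^ p and 1. *)
Lemma powR_bernoulli (R : realType) (p x : R) : 0 < p < 1 -> 0 <= x ->
  powR x p <= p * x + (1 - p).
Proof.
case/andP=> p0 p1 x0.
have p0' : 0 < p^-1 by rewrite invr_gt0.
have r0 : 0 < (1 - p)^-1 by rewrite invr_gt0 subr_gt0.
have E : p^-1^-1 + (1 - p)^-1^-1 = 1 by rewrite !invrK; lra.
have := conjugate_powR (powR_ge0 x p) ler01 p0' r0 E.
rewrite mulr1 powR1 -powRrM mulfV ?gt_eqF // powRr1 // !invrK mul1r => h.
by rewrite [p * x]mulrC.
Qed.

(** Each term is at most the increment of k ^ p, by concavity. *)
Lemma sum_powR_le (R : realType) (p : R) k : 0 < p < 1 ->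
  p * \sum_(a < k) powR a.+1%:R (p - 1) <= powR k%:R p.
Proof.
move=> p01; have /andP[p0 p1] := p01.
elim: k => [|k IHk]; first by rewrite big_ord0 mulr0 powR_ge0.
rewrite big_ord_recr /= mulrDr; apply: le_trans (lerD IHk (lexx _)) _.
set K : R := k.+1%:R; have K0 : 0 < K by rewrite ltr0Sn.
have kK : 0 <= k%:R / K by rewrite divr_ge0 // ltW.
have := powR_bernoulli p01 kK.
rewrite -(ler_pM2r (powR_gt0 p K0)) -powRM ?(ltW K0) // divfK ?gt_eqF //.
have -> : powR K p = K * powR K (p - 1) by rewrite mulr_powRB1 // ltW.
have -> : k%:R = K - 1 by rewrite /K -[k.+1]addn1 natrD addrK.
suff -> (M P : R) : 0 < M ->
  (p * ((M - 1) / M) + (1 - p)) * (M * P) = M * P - p * P by lra.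
by move=> M0; field; rewrite gt_eqF.
Qed.

Lemma harmonic_le (R : realType) k : \sum_(a < k.+1) a.+1%:R^-1 <= 1 + ln k.+1%:R :> R.
Proof.
elim: k => [|k IHk]; first by rewrite big_ord1 ln1 invr1 addr0.
rewrite big_ord_recr /=; apply: le_trans (lerD IHk (lexx _)) _.
rewrite -addrA lerD2l -lerBrDl.
have [K EK] : exists K : R, K = k.+2%:R by eexists.
have K1 : 1 < K by rewrite EK ltr1n.
have K0 : 0 < K by lra.
have [Ki0 Ki1] : 0 < K^-1 /\ K^-1 < 1 by rewrite invr_gt0 invf_lt1.
have : ln (1 + - K^-1) <= - K^-1 by apply: le_ln1Dx; lra.
have -> : 1 + - K^-1 = k.+1%:R / K.
  by rewrite -[k.+1%:R](addrK 1) natr1 -EK; field; rewrite gt_eqF.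
by rewrite ln_div ?posrE // -EK; lra.
Qed.

(** The constant of the first sum is exactly 1, which is what makes k ^ (1 - 1/l) the
main term.  For l = 2 the second sum is harmonic: this is where log k comes
from. *)
Lemma loss_exponent_le (R : realType) (l : nat) : (2 <= l)%N ->
  exists2 D : R, 0 <= D & forall k,
    \sum_(a < k.+1) ((1 - l%:R^-1) * (root_l R l a.+1)^-1 + 3 * (root_l R l a.+1) ^- 2)
    <= powR k.+1%:R (1 - l%:R^-1) +
       D * (powR k.+1%:R (1 - 2 / l%:R) + ln k.+1%:R).
Proof.
move=> l2; have [li0 li2] := @l_inv R l l2.
have root1 k : \sum_(a < k) (1 - l%:R^-1) * (root_l R l a.+1)^-1 <= powR k%:R (1 - l%:R^-1).
  rewrite -mulr_sumr; apply: le_trans (sum_powR_le _ _); last by lra.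
  rewrite ler_wpM2l //; first by lra.
  apply: ler_sum => a _; rewrite /root_l -powRN.
  by have -> : 1 - l%:R^-1 - 1 = - l%:R^-1 :> R by ring.
have root2 a : (root_l R l a.+1) ^- 2 = powR a.+1%:R (1 - 2 / l%:R - 1).
  rewrite /root_l -powR_mulrn ?powR_ge0 // -powRrM -powRN; congr powR.
  by ring.
have lnk k : 0 <= ln k.+1%:R :> R by rewrite ln_ge0 // ler1n.
suff [D D0 hD] : exists2 D : R, 0 <= D & forall k,
    \sum_(a < k.+1) 3 * powR a.+1%:R (1 - 2 / l%:R - 1) <=
      D * (powR k.+1%:R (1 - 2 / l%:R) + ln k.+1%:R).
  exists D => // k; rewrite big_split /=; apply: lerD; first exact: root1.
  by under eq_bigr do rewrite root2; apply: hD.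
have [->|ln2] := eqVneq l 2%N.
  exists 3 => // k; rewrite divff ?pnatr_eq0 // subrr powRr0 -mulr_sumr ler_wpM2l //.
  under eq_bigr do rewrite sub0r powR_inv1 //.
  exact: harmonic_le.
have l3 : l%:R^-1 <= 3^-1 :> R.
  by rewrite lef_pV2 ?posrE ?ltr0n ?ler_nat //; lia.
have [p Ep] : exists p : R, p = 1 - 2 / l%:R by eexists.
have p0 : 0 < p by rewrite Ep; lra.
have p01 : 0 < p < 1 by rewrite p0 Ep; lra.
rewrite -Ep; exists (3 / p); first by rewrite divr_ge0 // ltW.
move=> k; rewrite -mulr_sumr -mulrA ler_wpM2l // ler_pdivlMl //.
by apply: le_trans (sum_powR_le _ p01) _; rewrite lerDl.
Qed.

(** * The Ramsey number *)

Lemma ramsey_le_capacity (R : realType) (l k n : nat) : (2 <= l)%N ->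
  ~~ ramsey_prop k.+1 (cycle_graph (2 * l + 1)) n ->
  n%:R <= capacity l (layer_loss R l) k.+1.
Proof.
move=> l2 /forallPn[chi nomono].
pose c (x y : 'I_n) : 'I_k.+1 :=
  if (insub [set x; y] : option (Kedge n)) is Some e then chi e else ord0.
have cE e x y : val e = [set x; y] -> c x y = chi e by rewrite /c => <-; rewrite valK.
have c_sym x y : c x y = c y x by rewrite /c setUC.
have c_nocycle i s : size s = l.*2.+1 -> uniq s -> ~~ cycle (fun x y => c x y == i) s.
  move=> szs us; apply: contra nomono => cs.
  (* the i-th vertex of the cycle graph goes to the i-th entry of s *)
  case: s szs us cs => // x0 s0; set s := x0 :: s0 => szs us cs.
  have sz : size s = (2 * l + 1)%N by rewrite szs; lia.
  have xs (x : 'I_(2 * l + 1)) : nth x0 s x \in s by rewrite mem_nth // sz.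
  have nextE (x : 'I_(2 * l + 1)) : c (nth x0 s x) (nth x0 s (ordS x)) == i.
    have := next_cycle cs (xs x); rewrite next_nth xs index_uniq ?sz //.
    suff -> : nth x0 s (ordS x) = nth x0 s0 x by [].
    have [xlt|xge] := ltnP x.+1 (2 * l + 1); first by rewrite /= modn_small.
    have Es : (size s0).+1 = (2 * l + 1)%N by [].
    have Ex : nat_of_ord x = size s0 by have := ltn_ord x; lia.
    have E0 : nat_of_ord (ordS x) = 0%N by rewrite /= Ex Es modnn.
    by rewrite E0 [RHS]nth_default ?Ex.
  apply/existsP; exists [ffun x => nth x0 s (nat_of_ord x)].
  apply/existsP; exists i; apply/andP; split.
    apply/injectiveP => x y; rewrite !ffunE => /eqP.
    by rewrite nth_uniq ?sz // => /eqP/val_inj.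
  apply/forallP => x; apply/forallP => y; apply/implyP => /= /andP[_ xy].
  apply/forallP => e; apply/implyP; rewrite !ffunE => /eqP/cE<-.
  by case/orP: xy => /eqP->; rewrite ?nextE // c_sym nextE.
have cap1 a : 1 <= capacity l (layer_loss R l) a.
  apply: le_trans (capacity_quadratic R l2 a).
  by rewrite exprn_ege1 // ler1n.
have := @list_weight_sum R l (layer_loss R l) _ _ c (layer_growth_rate R l) l2
  c_sym c_nocycle (rate_gt0 R l2) (fun=> erefl) (loss_mono R l2) cap1 (loss_large R l2)
  setT (fun=> setT).
have adm : admissible c setT (fun=> setT) by move=> x y; rewrite !inE.
move=> /(_ adm); rewrite /weight sumr_const !cardsT !card_ord -[list_weight _ _ _ *+ _]mulr_natl.
by rewrite ler_pdivrMr ?mul1r //; apply: lt_le_trans (cap1 _).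
Qed.

Theorem theorem5 (R : realType) (l : nat) (hl : (2 <= l)%N) :
  exists (C : R) (k0 : nat), forall k : nat, (k0 <= k)%N ->
    exists E : R,
      `|E| <= C * (powR k%:R (1 - 2%:R / l%:R) + ln k%:R) /\
      (ramsey k (cycle_graph (2 * l + 1)))%:R <=
        2 * l%:R / (2 * l%:R - 1) * (2 * l%:R - 1) ^+ k
        * powR k`!%:R (1 / l%:R)
        * expR (powR k%:R (1 - 1 / l%:R) + E) + 1.
Proof.
(* only an upper bound is claimed, so the error term is taken as large as allowed *)
have [D D0 hD] := loss_exponent_le R hl.
exists D, 1%N => -[|k] // _.
exists (D * (powR k.+1%:R (1 - 2 / l%:R) + ln k.+1%:R)).
have err0 : 0 <= D * (powR k.+1%:R (1 - 2 / l%:R) + ln k.+1%:R).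
  by rewrite mulr_ge0 // addr_ge0 ?powR_ge0 // ln_ge0 // ler1n.
split; first by rewrite ger0_norm.
have l2 : 2%:R <= l%:R :> R by rewrite ler_nat.
have b0 : 0 < 2 * l%:R - 1 :> R by lra.
set G := 2 * l%:R / _ * _ * _ * _.
suff capG : capacity l (layer_loss R l) k.+1 <= G.
  rewrite /ramsey; case: ex_minnP => -[|n] _ minn; last first.
    rewrite -natr1 lerD2r; apply: le_trans capG; apply: ramsey_le_capacity => //.
    by apply/negP => /minn; rewrite ltnn.
  rewrite addr_ge0 //; apply: le_trans capG.
  by apply: le_trans (capacity_quadratic R hl k.+1); rewrite exprn_ge0.
apply: le_trans (capacity_le R hl k.+1) _.
set P := _ * expR _.
have -> : G = 2 * l%:R / (2 * l%:R - 1) * ((2 * l%:R - 1) ^+ k.+1 *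
    powR k.+1`!%:R l%:R^-1 * expR (powR k.+1%:R (1 - l%:R^-1) +
    D * (powR k.+1%:R (1 - 2 / l%:R) + ln k.+1%:R))).
  by rewrite /G !div1r !mulrA.
set Q := _ * expR _.
apply: (@le_trans _ _ Q); last first.
  rewrite ler_peMl //; first by rewrite !mulr_ge0 ?exprn_ge0 ?powR_ge0 ?expR_ge0 // ltW.
  by rewrite ler_pdivlMr // mul1r; lra.
by rewrite ler_wpM2l ?ler_expR ?hD // mulr_ge0 ?powR_ge0 // exprn_ge0 // ltW.
Qed.
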